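(* There exists a $4$-dimensional convex polytope whose graph is isomorphic to the graph of the $5$-dimensional cube and which is not cubical.
   Context: A combinatorial cube is a polytope combinatorially equivalent to $[0,1]^k$ for some $k$. A polytope is cubical if all of its proper faces are combinatorial cubes. The graph of a polytope is the graph formed by its vertices and edges. *)

(* Defs.v *)
From HB Require Import structures.
From mathcomp Require Import all_boot all_order all_algebra.
From mathcomp Require Import all_classical all_reals.

Set Implicit Arguments.
Unset Strict Implicit.
Unset Printing Implicit Defensive.

Import Order.TTheory GRing.Theory Num.Theory.
Local Open Scope classical_set_scope.
Local Open Scope ring_scope.

Definition convex_hull (R : realType) (d : nat) (S : set 'rV[R]_d) :
    set 'rV[R]_d :=
  [set x | exists (n : nat) (p : 'I_n -> 'rV[R]_d) (w : 'I_n -> R),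
    [/\ forall i, S (p i), forall i, 0 <= w i,
        \sum_i w i = 1 & x = \sum_i w i *: p i]].

Definition affine_hull (R : realType) (d : nat) (S : set 'rV[R]_d) :
    set 'rV[R]_d :=
  [set x | exists (n : nat) (p : 'I_n -> 'rV[R]_d) (w : 'I_n -> R),
    [/\ forall i, S (p i), \sum_i w i = 1 & x = \sum_i w i *: p i]].

(* The affine hull of [S] is a translate of a [k]-dimensional linear subspace.
   The empty set has no dimension in this sense. *)
Definition has_dim (R : realType) (d : nat) (S : set 'rV[R]_d) (k : nat) :
    Prop :=
  exists (x0 : 'rV[R]_d) (U : {vspace 'rV[R]_d}),
    affine_hull S = [set x | x - x0 \in U] /\ \dim U = k.

Definition is_polytope (R : realType) (d : nat) (P : set 'rV[R]_d) : Prop :=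
  exists S : set 'rV[R]_d, finite_set S /\ P = convex_hull S.

Definition dot (R : realType) (d : nat) (a x : 'rV[R]_d) : R :=
  \sum_(i < d) a 0 i * x 0 i.

(* A face is cut out by a valid inequality [dot a x <= b].  Taking [a = 0] shows
   that [P] (for [b = 0]) and [set0] (for [b = 1]) are faces of [P]. *)
Definition is_face (R : realType) (d : nat) (P F : set 'rV[R]_d) : Prop :=
  exists (a : 'rV[R]_d) (b : R),
    (forall x, P x -> dot a x <= b) /\ F = P `&` [set x | dot a x = b].

Definition faces (R : realType) (d : nat) (P : set 'rV[R]_d) :
    set (set 'rV[R]_d) :=
  [set F | is_face P F].

(* Isomorphism of face lattices. *)
Definition comb_equiv (R : realType) (d e : nat) (P : set 'rV[R]_d)
    (Q : set 'rV[R]_e) : Prop :=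
  exists phi : set 'rV[R]_d -> set 'rV[R]_e,
    set_bij (faces P) (faces Q) phi /\
    (forall F G, faces P F -> faces P G -> (F `<=` G <-> phi F `<=` phi G)).

Definition cube (R : realType) (k : nat) : set 'rV[R]_k :=
  [set x | forall i, 0 <= x 0 i <= 1].

Definition combinatorial_cube (R : realType) (d : nat) (P : set 'rV[R]_d) :
    Prop :=
  is_polytope P /\ exists k : nat, comb_equiv P (@cube R k).

(* The empty face, of dimension -1, is not required to be a cube: it is not
   combinatorially equivalent to any [cube R k]. *)
Definition cubical (R : realType) (d : nat) (P : set 'rV[R]_d) : Prop :=
  forall F, is_face P F -> F <> P -> F <> set0 -> combinatorial_cube F.

Definition vertices (R : realType) (d : nat) (P : set 'rV[R]_d) :
    set 'rV[R]_d :=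
  [set v | is_face P [set v]].

(* [u] and [v] are the two endpoints of an edge, i.e. of a face of dimension
   one. *)
Definition adjacent (R : realType) (d : nat) (P : set 'rV[R]_d)
    (u v : 'rV[R]_d) : Prop :=
  [/\ vertices P u, vertices P v, u <> v &
      exists F, [/\ is_face P F, has_dim F 1, F u & F v]].

Definition graph_isomorphic (R : realType) (d e : nat) (P : set 'rV[R]_d)
    (Q : set 'rV[R]_e) : Prop :=
  exists f : 'rV[R]_d -> 'rV[R]_e,
    set_bij (vertices P) (vertices Q) f /\
    (forall u v, vertices P u -> vertices P v ->
       (adjacent P u v <-> adjacent Q (f u) (f v))).

(* Main.v *)
Require Import Defs.
From HB Require Import structures.
From Corelib Require Import BinNums.
From mathcomp Require Import all_boot all_order all_algebra.
From mathcomp Require Import all_classical all_reals.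
From mathcomp Require Import ssrZ zify lra.

Set Implicit Arguments.
Unset Strict Implicit.
Unset Printing Implicit Defensive.

Import Order.TTheory GRing.Theory Num.Theory.
Local Open Scope classical_set_scope.
Local Open Scope ring_scope.

(* Over the triangle with corners A = (-5, 0), B = (5, 0), C = (0, 5) let g be the
   concave piecewise linear function min(7, 6 + q - |p|, 11 - q - 2|p|), whose
   five domains of linearity are quadrangles: an inner one and one around each of
   the sides AD, DB, BC, CA of its boundary, D being the midpoint of AB.  The
   polytope is {(x, y, p, q) | |x| <= g(p, q), |y| <= g(p, q)}.  Its graph is the
   product of the graph of this subdivision, which is the 3-cube, with a 4-cycle
   coming from the signs of x and y.  The facet over AB has 12 vertices, because
   D breaks the side, so it is not a cube.

   Edges are exposed by sums of facet inequalities.  A pair u, v is shown not to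
   be an edge by writing a point of the segment uv as a convex combination of
   vertices not all on the line uv. *)

(** * Faces of convex hulls and one-dimensional faces *)

Section Hulls.
Variables (R : realType) (d : nat).
Implicit Types (S P F : set 'rV[R]_d) (a x u v w : 'rV[R]_d) (b : R).

Lemma dotDr a x y : dot a (x + y) = dot a x + dot a y.
Proof. by rewrite /dot -big_split; apply: eq_bigr => i _; rewrite mxE mulrDr. Qed.

Lemma dotZr a k x : dot a (k *: x) = k * dot a x.
Proof.
by rewrite /dot mulr_sumr; apply: eq_bigr => i _; rewrite mxE mulrCA.
Qed.

Lemma dot_sumr a n (p : 'I_n -> 'rV[R]_d) (c : 'I_n -> R) :
  dot a (\sum_i c i *: p i) = \sum_i c i * dot a (p i).
Proof.
rewrite /dot; under [RHS]eq_bigr do rewrite mulr_sumr.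
rewrite exchange_big; apply: eq_bigr => j _.
rewrite summxE mulr_sumr; apply: eq_bigr => i _.
by rewrite mxE mulrCA.
Qed.

Lemma sub_convex_hull S : S `<=` convex_hull S.
Proof.
move=> x Sx; exists 1%N, (fun=> x), (fun=> 1); split=> //.
- by rewrite big_ord1.
- by rewrite big_ord1 scale1r.
Qed.

Lemma convex_hull_le S a b : (forall x, S x -> dot a x <= b) ->
  forall x, convex_hull S x -> dot a x <= b.
Proof.
move=> Sab x [n [p [c [Sp c0 c1 ->]]]].
rewrite dot_sumr -[leRHS]mul1r -c1 mulr_suml.
by apply: ler_sum => i _; rewrite ler_wpM2l// Sab.
Qed.

(** The slacks [c i * (b - dot a (p i))] are nonnegative and sum to zero, so every point of positive
    weight is tight. *)
Lemma convex_hullI S a b : (forall x, S x -> dot a x <= b) ->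
  convex_hull S `&` [set x | dot a x = b] =
  convex_hull (S `&` [set x | dot a x = b]).
Proof.
move=> Sab; apply/seteqP; split=> x.
- case=> -[n [p [c [Sp c0 c1 ->]]]] /=; rewrite dot_sumr => cb.
  have c_slack i : c i * (b - dot a (p i)) = 0.
    have /eqP : \sum_i c i * (b - dot a (p i)) = 0.
      under eq_bigr do rewrite mulrBr.
      by rewrite sumrB cb -mulr_suml c1 mul1r subrr.
    rewrite psumr_eq0 => [/allP/(_ i)|j _].
      by rewrite mem_index_enum => /(_ isT)/eqP.
    by rewrite mulr_ge0// subr_ge0 Sab.
  have tight i : c i != 0 -> dot a (p i) = b.
    move=> ci0; have /eqP := c_slack i.
    by rewrite mulf_eq0 (negbTE ci0) subr_eq0 => /eqP.
  have [i0 ci0] : exists i, c i != 0.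
    apply/existsP; apply: contraTT isT => /existsPn c_eq0.
    have : \sum_i c i = 0 by apply: big1 => i _; exact/eqP/negbNE/c_eq0.
    by rewrite c1 => /eqP; rewrite oner_eq0.
  (* Points of weight zero need not be tight; the tight point [p i0] replaces them. *)
  exists n, (fun i => if c i == 0 then p i0 else p i), c; split=> //.
  + by move=> i; case: eqVneq => [_|ci]; split; rewrite /= ?tight.
  + by apply: eq_bigr => i _; case: eqVneq => [->|//]; rewrite !scale0r.
- case=> n [p [c [Sp c0 c1 ->]]]; split.
    by exists n, p, c; split=> // i; case: (Sp i).
  rewrite /= dot_sumr (eq_bigr (fun i => c i * b)) => [|i _].
    by rewrite -mulr_suml c1 mul1r.
  by case: (Sp i) => _ /= ->.
Qed.

Lemma convex_hull0 : convex_hull (@set0 'rV[R]_d) = set0.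
Proof.
apply/seteqP; split=> // x [[|n] [p [c [Sp _ + _]]]]; last by have := Sp ord0.
by rewrite big_ord0 => /eqP; rewrite eq_sym oner_eq0.
Qed.

Lemma convex_hull1 u : convex_hull [set u] = [set u].
Proof.
apply/seteqP; split; last exact: sub_convex_hull.
move=> x [n [p [c [Sp _ c1 ->]]]] /=.
rewrite (eq_bigr (fun i => c i *: u)) => [|i _]; last by rewrite Sp.
by rewrite -scaler_suml c1 scale1r.
Qed.

Lemma has_dim1_convex_hull2 u v : u <> v ->
  has_dim (convex_hull [set u; v]) 1.
Proof.
move=> uv; exists u, <[v - u]>%VS; split; last first.
  by rewrite dim_vline subr_eq0 eq_sym (introF eqP uv).
have line x : convex_hull [set u; v] x -> exists t, x = u + t *: (v - u).
  case=> n [p [c [Sp _ c1 ->]]].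
  exists (\sum_i (if p i == u then 0 else c i)).
  have {1}-> : u = \sum_i c i *: u by rewrite -scaler_suml c1 scale1r.
  rewrite scaler_suml -big_split.
  apply: eq_bigr => i _ /=; case: eqVneq => [->|/eqP pu].
    by rewrite scale0r addr0.
  by case: (Sp i) => //= ->; rewrite -scalerDr addrC subrK.
apply/seteqP; split=> x /=.
- case=> n [p [c [Fp c1 ->]]]; apply/vlineP.
  have /choice[t pE] : forall i, exists t, p i = u + t *: (v - u).
    by move=> i; exact/line/Fp.
  exists (\sum_i c i * t i).
  have {1}-> : u = \sum_i c i *: u by rewrite -scaler_suml c1 scale1r.
  rewrite scaler_suml -sumrB.
  by apply: eq_bigr => i _; rewrite pE scalerDr addrC addKr scalerA.
- move=> /vlineP[t xE].
  exists 2%N, (fun i => if i == ord0 then u else v),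
    (fun i => if i == ord0 then 1 - t else t); split.
  + move=> i; case: ifP => _; apply: sub_convex_hull; by [left|right].
  + by rewrite big_ord_recl big_ord1 /= subrK.
  + rewrite big_ord_recl big_ord1 /= -[LHS](subrK u) xE.
    by rewrite scalerBr scalerBl scale1r addrC addrA addrAC.
Qed.

(** The direction space of the affine hull has dimension 1 and contains [v - u], which is nonzero,
    so [v - u] spans it. *)
Lemma has_dim1_collinear F u v w : has_dim F 1 -> F u -> F v -> F w ->
  u <> v -> exists t, w - u = t *: (v - u).
Proof.
move=> [x0 [U [FU dU]]] Fu Fv Fw uv.
have FU' x : F x -> x - x0 \in U.
  move=> Fx; suff : affine_hull F x by rewrite FU.
  exists 1%N, (fun=> x), (fun=> 1); split=> //; first by rewrite big_ord1.
  by rewrite big_ord1 scale1r.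
have subU x y : F x -> F y -> y - x \in U.
  move=> Fx Fy; suff -> : y - x = (y - x0) - (x - x0) by rewrite rpredB ?FU'.
  by rewrite opprB addrA subrK.
have : w - u \in <[v - u]>%VS.
  have /eqP -> : (<[v - u]> == U)%VS.
    rewrite eqEdim -memvE subU//= dU dim_vline subr_eq0 eq_sym.
    by rewrite (introF eqP uv).
  exact: subU.
by move=> /vlineP[t ->]; exists t.
Qed.

Lemma is_face_sub P F : is_face P F -> F `<=` P.
Proof. by move=> [a [b [_ ->]]] x []. Qed.

Lemma is_face_set0 P : is_face P set0.
Proof.
exists 0, 1; have dot0 x : dot 0 x = 0.
  by rewrite /dot big1// => i _; rewrite mxE mul0r.
split=> [x _|]; first by rewrite dot0.
apply/seteqP; split=> // x [_ /=]; rewrite dot0 => /eqP.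
by rewrite eq_sym oner_eq0.
Qed.

Lemma is_face_restrict P F G : is_face P G -> F `<=` P -> G `<=` F ->
  is_face F G.
Proof.
move=> [a [b [Pab GE]]] FP GF; exists a, b; split=> [x Fx|].
  exact/Pab/FP.
apply/seteqP; split=> [x Gx|x [Fx xb]]; last by rewrite GE; split=> //; exact: FP.
by split; [exact: GF | move: Gx; rewrite GE => -[]].
Qed.

(* A face containing a point [alpha u + beta v] of an open segment contains
   every point that has positive weight in a convex combination giving it. *)
Lemma is_face_relation P F u v n (p : 'I_n -> 'rV[R]_d) (c : 'I_n -> R)
    (alpha beta : R) :
  is_face P F -> F u -> F v -> (forall i, P (p i)) -> (forall i, 0 <= c i) ->
  \sum_i c i = alpha + beta ->
  \sum_i c i *: p i = alpha *: u + beta *: v ->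
  forall i, 0 < c i -> F (p i).
Proof.
move=> [a [b [Pab ->]]] [_ /= ub] [_ /= vb] Pp c0 c1 cE i ci0.
split; first exact: Pp.
have : \sum_i c i * (b - dot a (p i)) = 0.
  under eq_bigr do rewrite mulrBr.
  rewrite sumrB -dot_sumr cE dotDr !dotZr ub vb -mulr_suml c1.
  by rewrite mulrDl subrr.
move=> /eqP; rewrite psumr_eq0 => [/allP/(_ i)|j _]; last first.
  by rewrite mulr_ge0// subr_ge0 Pab.
rewrite mem_index_enum => /(_ isT).
by rewrite /= mulf_eq0 gt_eqF//= subr_eq0 => /eqP.
Qed.

(** The face [[set v]] is the hull of the tight points of [S]; being nonempty, it contains such a
    point, which must be [v]. *)
Lemma vertices_convex_hull_sub S : vertices (convex_hull S) `<=` S.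
Proof.
move=> v [a [b [Sab vE]]].
have Sab' x : S x -> dot a x <= b by move=> Sx; exact/Sab/sub_convex_hull.
rewrite convex_hullI// in vE.
have [s ST] : S `&` [set x | dot a x = b] !=set0.
  apply/set0P/eqP => S0; move: vE; rewrite S0 convex_hull0 => v0.
  by have : [set v] v by []; rewrite v0.
by have : [set v] s by [rewrite vE; exact: sub_convex_hull]; move=> /= <-; case: ST.
Qed.

Lemma face_convex_hull_vertex S F : S `<=` vertices (convex_hull S) ->
  is_face (convex_hull S) F -> F <> set0 ->
  exists2 v, vertices (convex_hull S) v & F v.
Proof.
move=> SV [a [b [Sab ->]]].
have Sab' x : S x -> dot a x <= b by move=> Sx; exact/Sab/sub_convex_hull.
rewrite convex_hullI// => F0.
have [s ST] : S `&` [set x | dot a x = b] !=set0.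
  by apply/set0P/eqP => S0; apply: F0; rewrite S0 convex_hull0.
by exists s; [apply: SV; case: ST | exact: sub_convex_hull].
Qed.

End Hulls.

(** * The number of vertices as an invariant of the face lattice *)

Section CombEquiv.
Variables (R : realType) (d e : nat) (P : set 'rV[R]_d) (Q : set 'rV[R]_e).
Hypothesis P_vertex : forall F, is_face P F -> F <> set0 ->
  exists2 v, vertices P v & F v.
Hypothesis Q_vertex : forall F, is_face Q F -> F <> set0 ->
  exists2 v, vertices Q v & F v.

(* Vertices are the atoms of the face lattice. *)
Lemma comb_equiv_card_vertices : comb_equiv P Q ->
  (vertices P #= vertices Q)%card.
Proof.
move=> [phi [[phiF phiI phiS] phi_le]].
have phi0 : phi set0 = set0.
  have [G PG G0] := phiS _ (is_face_set0 Q).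
  apply/seteqP; split=> //; rewrite -G0.
  by apply/(phi_le _ _ (is_face_set0 P) PG); exact: sub0set.
have phiN0 F : is_face P F -> F <> set0 -> phi F <> set0.
  move=> PF F0 pF0; apply: F0; apply: phiI; rewrite ?inE ?phi0//.
  exact: is_face_set0.
have set1N0 (T : Type) (x : T) : [set x] <> set0.
  by move=> x0; have : [set x] x by []; rewrite x0.
have sub1 (T : Type) (x : T) (A : set T) :
    A `<=` [set x] -> A <> set0 -> A = [set x].
  by move=> /subset_set1[].
have imE : phi @` (set1 @` vertices P) = set1 @` vertices Q.
  apply/seteqP; split=> G /=.
  - move=> [_ [v Pv <-] <-].
    (* A vertex [w] in [phi [set v]] gives [[set w] = phi H] with [H] nonempty and contained in
       [[set v]], hence equal to it. *)
    have [w Qw vw] := Q_vertex (phiF _ Pv) (phiN0 _ Pv (@set1N0 _ v)).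
    have [H PH Hw] := phiS _ Qw.
    have H0 : H <> set0.
      by move=> H0; move: Hw; rewrite H0 phi0 => /esym; exact: set1N0.
    exists w => //; rewrite -Hw; congr phi; apply: sub1 => //.
    by apply/(phi_le _ _ PH Pv); rewrite Hw => _ /= ->.
  - move=> [w Qw <-]; have [H PH Hw] := phiS _ Qw.
    have H0 : H <> set0.
      by move=> H0; move: Hw; rewrite H0 phi0 => /esym; exact: set1N0.
    have [v Pv Hv] := P_vertex PH H0.
    exists [set v]; first by exists v.
    apply: sub1; last exact: phiN0.
    by rewrite -Hw; apply/(phi_le _ _ Pv PH) => _ /= ->.
have inj1 (T : Type) (A : set T) : {in A &, injective (@set1 T)}.
  by move=> x y _ _ xy; have : [set x] x by []; rewrite xy.
apply: card_eq_trans (inj_card_eq (@inj1 _ (vertices Q))).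
rewrite -imE card_eq_sym; apply: card_eq_trans (inj_card_eq (@inj1 _ (vertices P))).
apply: inj_card_eq => F G; rewrite !inE => -[v Pv <-] [w Pw <-].
by apply: phiI; rewrite inE.
Qed.

End CombEquiv.

(** * Faces, vertices and graph of the cube *)

Section Cube.
Variables (R : realType) (k : nat).
Implicit Types (b : {ffun 'I_k -> bool}).

Definition corner b : 'rV[R]_k := \row_i (b i)%:R.

Lemma corner_inj : injective corner.
Proof.
move=> b b' /rowP bb'; apply/ffunP => i; have /eqP := bb' i.
by rewrite !mxE eqr_nat; case: (b i); case: (b' i).
Qed.

Lemma cube_corner b : cube (corner b).
Proof. by move=> i; rewrite mxE ler0n lern1 leq_b1. Qed.

(** Rounding each coordinate according to the sign of [a 0 i] does not decrease [dot a], so a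
    maximizer may be taken among the corners. *)
Lemma cube_face_corner F : is_face (@cube R k) F -> F <> set0 ->
  exists b, F (corner b).
Proof.
move=> [a [m [am ->]]] /eqP/set0P[x [xQ /= xm]].
pose b := [ffun i => 0 < a 0 i]; exists b; split; first exact: cube_corner.
apply/eqP; rewrite eq_le am /=; last exact: cube_corner.
rewrite -xm; apply: ler_sum => i _; rewrite mxE ffunE.
have /andP[x0 x1] := xQ i; case: ltP => ai.
  by rewrite ler_pM2l.
by rewrite mulr0 mulr_le0_ge0.
Qed.

(** Keeping the equality case lets a sum over [D] yield both a valid inequality and the face it cuts
    out. *)
Lemma signed_coord_le (b : bool) (x : R) : 0 <= x <= 1 ->
  (-1) ^+ (~~ b) * x <= b%:R ?= iff (x == b%:R).
Proof.
move=> /andP[x0 x1]; case: b => /=.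
  by rewrite mul1r; split.
by rewrite expr1 mulN1r; split; rewrite ?oppr_le0 ?oppr_eq0.
Qed.

Definition subcube b (D : {set 'I_k}) : set 'rV[R]_k :=
  @cube R k `&` [set x | forall i, i \in D -> x 0 i = (b i)%:R].

Lemma is_face_subcube b (D : {set 'I_k}) : is_face (@cube R k) (subcube b D).
Proof.
exists (\row_i (if i \in D then (-1) ^+ (~~ b i) else 0)),
  (\sum_(i in D) (b i)%:R).
have dotE (x : 'rV[R]_k) :
    dot (\row_i (if i \in D then (-1) ^+ (~~ b i) else 0)) x =
    \sum_(i in D) (-1) ^+ (~~ b i) * x 0 i.
  rewrite /dot [RHS]big_mkcond; apply: eq_bigr => i _.
  by rewrite mxE; case: ifP => // _; rewrite mul0r.
have le_sum (x : 'rV[R]_k) (xQ : cube x) :=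
  leif_sum (fun i (_ : i \in D) => signed_coord_le (b i) (xQ i)).
split=> [x xQ|]; first by rewrite dotE; case: (le_sum x xQ).
apply/seteqP; split=> x [xQ] /= => [xD|].
  split=> //=; rewrite dotE; apply/eqP; rewrite (le_sum x xQ).2.
  by apply/forallP => i; apply/implyP => iD; rewrite xD.
rewrite dotE => /eqP; rewrite (le_sum x xQ).2 => /forallP xD.
by split=> // i iD; have /implyP/(_ iD)/eqP := xD i.
Qed.

Lemma vertices_cube : vertices (@cube R k) = range corner.
Proof.
apply/seteqP; split=> [v Fv|_ [b _ <-]].
  have [|b <-] := cube_face_corner Fv; last by exists b.
  by move=> v0; have : [set v] v by []; rewrite v0.
have := is_face_subcube b [set: 'I_k]%SET; rewrite /vertices /=; congr is_face.
apply/seteqP; split=> [x [_ /= xb]|_ ->].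
  by apply/rowP => i; rewrite mxE xb// inE.
by split; [exact: cube_corner | move=> i _; rewrite mxE].
Qed.

Lemma cube_face_vertex F : is_face (@cube R k) F -> F <> set0 ->
  exists2 v, vertices (@cube R k) v & F v.
Proof.
move=> QF F0; have [b Fb] := cube_face_corner QF F0.
by exists (corner b) => //; rewrite vertices_cube; exists b.
Qed.

Lemma card_vertices_cube : (vertices (@cube R k) #= `I_(2 ^ k))%card.
Proof.
rewrite vertices_cube.
apply: card_eq_trans (inj_card_eq (in2W corner_inj)) _.
have -> : `I_(2 ^ k) = [set (enum_rank b : nat) | b in [set: {ffun 'I_k -> bool}]].
  have c2 : #|{: {ffun 'I_k -> bool}}| = (2 ^ k)%N.
    by rewrite card_ffun card_bool card_ord.
  apply/seteqP; split=> [i /= |_ [b _ <-]] /=; last by rewrite -c2 ltn_ord.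
  rewrite -c2 => i2; exists (enum_val (Ordinal i2)) => //.
  by rewrite enum_valK.
rewrite card_eq_sym; apply: inj_card_eq => b b' _ _ bb'.
exact/enum_rank_inj/val_inj.
Qed.

Lemma corner_edge b b' i : (forall j, (b j != b' j) = (j == i)) ->
  adjacent (@cube R k) (corner b) (corner b').
Proof.
move=> bb'.
have Nbb' : corner b <> corner b'.
  by move=> /corner_inj E; have := bb' i; rewrite E !eqxx.
split=> //; try by rewrite vertices_cube; eexists.
have bE j : j != i -> b' j = b j.
  by move=> ji; have := bb' j; rewrite (negbTE ji) => /negbFE/eqP.
have biE : b' i = ~~ b i by have := bb' i; rewrite eqxx; case: (b i); case: (b' i).
exists (subcube b [set~ i]%SET).
split.
- exact: is_face_subcube.
- suff -> : subcube b [set~ i]%SET = convex_hull [set corner b; corner b'].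
    exact: has_dim1_convex_hull2.
  apply/seteqP; split=> [x [xQ /= xb]|_ [n [p [c [pS c0 c1 ->]]]]].
  + pose t := if b i then 1 - x 0 i else x 0 i.
    have t01 : 0 <= t <= 1.
      by have := xQ i; rewrite /t; case: (b i) => //; lra.
    exists 2%N, (fun j => if j == ord0 then corner b else corner b'),
      (fun j => if j == ord0 then 1 - t else t); split.
    * by move=> j; case: ifP => _; [left|right].
    * by move=> j; case: ifP => _; lra.
    * by rewrite big_ord_recl big_ord1 /= subrK.
    * rewrite big_ord_recl big_ord1 /=; apply/rowP => j; rewrite !mxE.
      have [->|ji] := eqVneq j i.
        by rewrite biE /t; case: (b i) => /=; lra.
      by rewrite bE// xb ?inE// -mulrDl subrK mul1r.
  + have pQ j : cube (p j) by case: (pS j) => ->; exact: cube_corner.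
    split=> j /=.
      rewrite summxE sumr_ge0 /= => [|l _]; last first.
        by rewrite mxE mulr_ge0//; case/andP: (pQ l j).
      rewrite -c1; apply: ler_sum => l _; rewrite mxE ler_piMr//.
      by case/andP: (pQ l j).
    rewrite !inE => ji.
    rewrite summxE (eq_bigr (fun l => c l * (b j)%:R)) => [|l _].
      by rewrite -mulr_suml c1 mul1r.
    by rewrite mxE; case: (pS l) => ->; rewrite mxE ?bE.
- by split; [exact: cube_corner | move=> j _; rewrite mxE].
- split; [exact: cube_corner | move=> j; rewrite !inE => ji].
  by rewrite mxE bE.
Qed.

Lemma adjacent_corner b b' : adjacent (@cube R k) (corner b) (corner b') <->
  exists i, forall j, (b j != b' j) = (j == i).
Proof.
split=> [[_ _ Nbb' [F [QF F1 Fb Fb']]]|[i]]; last exact: corner_edge.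
have [i bi] : exists i, b i != b' i.
  apply: contrapT => /forallNP E; apply: Nbb'; congr corner.
  by apply/ffunP => i; exact/eqP/negPn/negP/E.
exists i => j; have [->//|ji] := eqVneq j i.
apply/negbTE/negP => bj.
(* If [b] and [b'] differ at both [i] and [j], exchanging coordinate [i] gives corners with
   [c + c' = b + b']; the face then contains [c], which is off the line. *)
pose c := [ffun l => if l == i then b' l else b l].
pose c' := [ffun l => if l == i then b l else b' l].
have Fc : F (corner c).
  have := @is_face_relation _ _ _ _ _ _ 2
    (fun l => if l == ord0 then corner c else corner c') (fun=> 1) 1 1 QF Fb Fb'.
  move=> /(_ _ _ _ _ ord0); apply=> //.
  - by move=> l; case: ifP => _; exact: cube_corner.
  - by rewrite big_ord_recl big_ord1.
  - rewrite big_ord_recl big_ord1 /=; apply/rowP => l; rewrite !mxE !ffunE.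
    by case: ifP => // _; rewrite addrC.
have [t /rowP tE] := has_dim1_collinear F1 Fb Fb' Fc Nbb'.
have := tE i; have := tE j; rewrite !mxE !ffunE eqxx (negbTE ji).
by move: bi bj; case: (b i); case: (b' i); case: (b j); case: (b' j) => //= _ _; lra.
Qed.

End Cube.

(** * Integer data of the polytope, verified by evaluation *)

(* A row [:: a; p; q] stands for the four vertices (+-a, +-a, p, q).  Rows 0, 1,
   3, 2 are the boundary points A, D, B, C of the triangle in cyclic order (D is
   the midpoint of AB), and row i + 4 is the interior point joined to row i. *)
Definition shadow : seq (seq Z) :=
  [:: [:: 1; -5; 0]; [:: 6; 0; 0]; [:: 6; 0; 5]; [:: 1; 5; 0];
      [:: 7; -1; 2]; [:: 7; 0; 1]; [:: 7; 0; 4]; [:: 7; 1; 2]].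

Definition bit (n l : nat) : bool := odd (n %/ 2 ^ l).

Definition sign (n l : nat) : Z := (-1) ^+ bit n l.

(* Bits 0-2 of [n] select a row of [shadow], bits 3 and 4 the two signs.  The
   last entry is a homogenizing coordinate. *)
Definition pt (n : nat) : seq Z :=
  let s := nth [::] shadow (n %% 8) in
  [:: sign n 3 * s`_0; sign n 4 * s`_0; s`_1; s`_2; 1].

Definition dotz (f p : seq Z) : Z :=
  foldr +%R 0 [seq f`_l * p`_l | l <- iota 0 5].

(* Each row [f] is the valid inequality [0 <= dotz f (pt n)]. *)
Definition facets : seq (seq Z) :=
  [:: [:: 0; 0; 0; 1; 0]; [:: 0; 0; 1; -1; 5]; [:: 0; 0; -1; -1; 5]] ++
  flatten [seq [:: [:: e.1; e.2; 0; 0; 7];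
                   [:: e.1; e.2; 1; 1; 6]; [:: e.1; e.2; -1; 1; 6];
                   [:: e.1; e.2; 2; -1; 11]; [:: e.1; e.2; -2; -1; 11]]
          | e <- [:: (1, 0); (-1, 0); (0, 1); (0, -1)]].

(** A sum of valid inequalities is tight exactly where every summand is. The seed [[::]] reads as
    zero through the default of [nth]. *)
Definition support (i j : nat) : seq Z :=
  foldr (fun f g => [seq f`_l + g`_l | l <- iota 0 5]) [::]
    [seq f <- facets | (dotz f (pt i) == 0) && (dotz f (pt j) == 0)].

Definition exposes (f : seq Z) (s : seq nat) : bool :=
  all (fun n => (0 <= dotz f (pt n)) && ((dotz f (pt n) == 0) == (n \in s)))
    (iota 0 32).

(** Adjacency in the graph of the 5-cube: binary codes at Hamming distance one. *)
Definition neighbours (i j : nat) : bool :=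
  count (fun l => bit i l != bit j l) (iota 0 5) == 1%N.

Lemma exposes_vertex : all (fun i => exposes (support i i) [:: i]) (iota 0 32).
Proof. exact: (erefl true). Qed.

Lemma exposes_edge :
  all (fun i => all (fun j => neighbours i j ==> exposes (support i j) [:: i; j])
    (iota 0 32)) (iota 0 32).
Proof. exact: (erefl true). Qed.

(* The facet over the side AB: two cubes glued along a square that is not one of
   its faces. *)
Definition bottom : seq nat := [seq n <- iota 0 32 | n %% 8 \in [:: 0; 1; 3]]%N.

Lemma bottom_sub : {subset bottom <= iota 0 32}.
Proof. exact: mem_subseq (filter_subseq _ _). Qed.

Lemma exposes_bottom : exposes [:: 0; 0; 0; 1; 0] bottom.
Proof. exact: (erefl true). Qed.

(* An entry [((i, j), (a, b, c))] records a relation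
   [a * s_i + b * s_j = \sum_l c_l * s_l] between the last two coordinates of the
   rows [s] of [shadow], with [a + b = \sum_l c_l], for which the first
   coordinates satisfy [<=] instead of [=]. *)
Definition relations : seq ((nat * nat) * (nat * nat * seq nat)) :=
  [:: ((0, 3), (1, 1, [:: 0; 2]));
      ((1, 2), (1, 1, [:: 0; 0; 0; 0; 0; 1; 1]));
      ((4, 7), (3, 3, [:: 0; 0; 0; 0; 0; 4; 2]));
      ((5, 6), (4, 2, [:: 0; 0; 0; 0; 3; 0; 0; 3]));
      ((0, 5), (1, 10, [:: 0; 6; 0; 0; 5]));
      ((1, 4), (6, 5, [:: 1; 0; 0; 0; 0; 10]));
      ((3, 5), (1, 10, [:: 0; 6; 0; 0; 0; 0; 0; 5]));
      ((1, 7), (6, 5, [:: 0; 0; 0; 1; 0; 10]));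
      ((0, 6), (1, 10, [:: 0; 0; 6; 0; 5]));
      ((2, 4), (6, 5, [:: 1; 0; 0; 0; 0; 0; 10]));
      ((3, 6), (1, 10, [:: 0; 0; 6; 0; 0; 0; 0; 5]));
      ((2, 7), (6, 5, [:: 0; 0; 0; 1; 0; 0; 10]));
      ((0, 7), (2, 5, [:: 0; 2; 0; 0; 5]));
      ((3, 4), (2, 5, [:: 0; 2; 0; 0; 0; 0; 0; 5]));
      ((1, 6), (3, 1, [:: 0; 0; 0; 0; 0; 4]));
      ((2, 5), (3, 1, [:: 0; 0; 0; 0; 0; 0; 4]))]%N.

(** The listed pairs are the rows at distance at least two in the 3-cube. Equal or adjacent rows get
    the trivial relation; there, points off the line come from changing signs. *)
Definition relation (i j : nat) : nat * nat * seq nat :=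
  if [seq e.2 | e <- relations & e.1 == (i, j)] is r :: _ then r
  else if [seq e.2 | e <- relations & e.1 == (j, i)] is (a, b, c) :: _
  then (b, a, c)
  else (1, 1, [seq (l == i) + (l == j) | l <- iota 0 8])%N.

(* Lifts a relation between rows of [shadow] to one between vertices.  With
   [m] the sum of the [c_l] times the first coordinate of row [l], the first two
   coordinates [x], [y] of [a * pt i + b * pt j] lie in [[-m, m]], so they are
   obtained by giving the four vertices over row [l] the weights
   [c_l * (m +- x) * (m +- y)], up to the factor [4 * m ^ 2]. *)
Definition certificate (i j : nat) : Z * Z * seq Z :=
  let: (a, b, c) := relation (i %% 8)%N (j %% 8)%N in
  let m : Z := foldr +%R 0
    [seq (nth 0%N c l)%:R * (nth [::] shadow l)`_0 | l <- iota 0 8] in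
  let x := a%:R * (pt i)`_0 + b%:R * (pt j)`_0 in
  let y := a%:R * (pt i)`_1 + b%:R * (pt j)`_1 in
  (4 * m ^+ 2 * a%:R, 4 * m ^+ 2 * b%:R,
   [seq (nth 0%N c (n %% 8)%N)%:R * ((m + sign n 3 * x) * (m + sign n 4 * y))
   | n <- iota 0 32]).

(** A nonzero 2 x 2 minor of the difference vectors, homogenizing entry omitted. *)
Definition noncollinear (i j n : nat) : bool :=
  has (fun l => has (fun l' =>
      ((pt j)`_l - (pt i)`_l) * ((pt n)`_l' - (pt i)`_l')
      != ((pt j)`_l' - (pt i)`_l') * ((pt n)`_l - (pt i)`_l))
    (iota 0 4)) (iota 0 4).

Definition separated (i j : nat) : bool :=
  let: (a, b, w) := certificate i j in
  [&& all (fun n => 0 <= w`_n) (iota 0 32),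
      all (fun l => foldr +%R 0 [seq w`_n * (pt n)`_l | n <- iota 0 32]
                    == a * (pt i)`_l + b * (pt j)`_l) (iota 0 5) &
      has (fun n => (0 < w`_n) && noncollinear i j n) (iota 0 32)].

Lemma separated_non_neighbours :
  all (fun i => all (fun j => [|| i == j, neighbours i j | separated i j])
    (iota 0 32)) (iota 0 32).
Proof. exact: (erefl true). Qed.

(** * From the integer data to the real polytope *)

Section Witness.
Variable R : realType.

Definition zr : Z -> R := intr \o int_of_Z.

HB.instance Definition _ := GRing.RMorphism.copy zr (intr \o int_of_Z).

Lemma zr_ge0 z : (0 <= zr z) = (0 <= z).
Proof. by rewrite /zr /= ler0z; case: z. Qed.

Lemma zr_eq0 z : (zr z == 0) = (z == 0).
Proof. by rewrite /zr /= intr_eq0 -[RHS](inj_eq (can_inj int_of_ZK)). Qed.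

Lemma zr_gt0 z : (0 < zr z) = (0 < z).
Proof. by rewrite !lt_def zr_ge0 zr_eq0. Qed.

Lemma zr_foldr (g : nat -> Z) n :
  zr (foldr +%R 0 [seq g m | m <- iota 0 n]) = \sum_(m < n) zr (g m).
Proof.
by rewrite foldrE big_map -{1}[n]subn0 -/(index_iota 0 n) big_mkord rmorph_sum.
Qed.

Lemma ord_iota n (m : 'I_n) : val m \in iota 0 n.
Proof. by rewrite mem_iota ltn_ord. Qed.

Definition point (n : nat) : 'rV[R]_4 := \row_l zr (pt n)`_l.

Definition points (s : seq nat) : set 'rV[R]_4 := [set point n | n in [set` s]].

Definition witness : set 'rV[R]_4 := convex_hull (points (iota 0 32)).

(** The sign turns [0 <= dotz f (pt n)] into the form [dot a x <= b] of a face inequality, with [b]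
    the homogenizing entry of [f]. *)
Definition covector (f : seq Z) : 'rV[R]_4 := \row_l - zr f`_l.

Lemma zr_dotz f n : zr (dotz f (pt n)) = zr f`_4 - dot (covector f) (point n).
Proof.
rewrite zr_foldr big_ord_recr /= rmorphM /= rmorph1 mulr1 addrC; congr +%R.
by rewrite /dot -sumrN; apply: eq_bigr => l _; rewrite rmorphM !mxE mulNr opprK.
Qed.

Lemma exposes_face f s : exposes f s -> {subset s <= iota 0 32} ->
  is_face witness (convex_hull (points s)).
Proof.
move=> /allP fs s32; exists (covector f), (zr f`_4).
have valid x : points (iota 0 32) x -> dot (covector f) x <= zr f`_4.
  by move=> [n /= /fs/andP[+ _] <-]; rewrite -zr_ge0 zr_dotz subr_ge0.
split; first exact: convex_hull_le.
rewrite convex_hullI//; congr convex_hull; apply/seteqP; split=> [_ [n /= ns <-]|].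
  split; first by exists n => //; exact: s32.
  have /andP[_ /eqP] := fs _ (s32 _ ns).
  rewrite ns -zr_eq0 zr_dotz subr_eq0.
  by move=> /eqP.
move=> _ [[n /= n32 <-] /= tight]; exists n => //=.
have /andP[_ /eqP <-] := fs _ n32.
by rewrite -zr_eq0 zr_dotz tight subrr.
Qed.

Lemma points_seq1 n : points [:: n] = [set point n].
Proof.
apply/seteqP; split=> [_ [m /= + <-]|_ ->]; first by rewrite inE => /eqP ->.
by exists n; rewrite //= inE.
Qed.

Lemma points_seq2 m n : points [:: m; n] = [set point m; point n].
Proof.
apply/seteqP; split=> [_ [l /= + <-]|_ [|] ->].
- by rewrite !inE => /orP[] /eqP ->; [left|right].
- by exists m; rewrite //= !inE eqxx.
- by exists n; rewrite //= !inE eqxx orbT.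
Qed.

Lemma point_vertex n : n \in iota 0 32 -> vertices witness (point n).
Proof.
move=> n32; have /allP/(_ n n32) := exposes_vertex.
move=> /exposes_face; rewrite points_seq1 convex_hull1; apply.
by move=> m; rewrite inE => /eqP ->.
Qed.

(** The functional exposing vertex [i] vanishes at no other listed point. *)
Lemma point_inj : {in iota 0 32 &, injective point}.
Proof.
move=> i j i32 j32 ij; have /allP/(_ i i32)/allP fi := exposes_vertex.
have : zr (dotz (support i i) (pt j)) == 0.
  rewrite zr_dotz -ij -zr_dotz zr_eq0.
  by have /andP[_ /eqP ->] := fi _ i32; rewrite inE.
rewrite zr_eq0; have /andP[_ /eqP ->] := fi _ j32.
by rewrite inE => /eqP.
Qed.

Lemma vertices_witness : vertices witness = points (iota 0 32).
Proof.
apply/seteqP; split; first exact: vertices_convex_hull_sub.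
by move=> _ [n n32 <-]; exact: point_vertex.
Qed.

Lemma separated_face i j F : i \in iota 0 32 -> j \in iota 0 32 ->
  separated i j -> is_face witness F -> F (point i) -> F (point j) ->
  exists2 n, F (point n) & noncollinear i j n.
Proof.
rewrite /separated; case: (certificate i j) => -[a b] w.
move=> i32 j32 /and3P[/allP w0 /allP wE /hasP[n n32 /andP[wn ijn]]] PF Fi Fj.
exists n => //.
have wsum l : l \in iota 0 5 ->
    \sum_(m < 32) zr w`_m * zr (pt m)`_l = zr a * zr (pt i)`_l + zr b * zr (pt j)`_l.
  move=> l5; have /eqP/(congr1 zr) := wE l l5.
  rewrite (zr_foldr (fun m => w`_m * (pt m)`_l)) rmorphD !rmorphM /= => <-.
  by apply: eq_bigr => m _; rewrite rmorphM.
have n32' : (n < 32)%N by rewrite mem_iota in n32.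
have := @is_face_relation _ _ _ _ _ _ 32 (fun m => point m) (fun m => zr w`_m)
  (zr a) (zr b) PF Fi Fj.
move=> /(_ _ _ _ _ (Ordinal n32')); apply => /=.
- move=> m; apply: sub_convex_hull; exists (val m) => //.
  exact: ord_iota.
- by move=> m; rewrite zr_ge0 w0// ord_iota.
(* The homogenizing coordinate of the certificate is the equality of total weights. *)
- have := wsum 4%N isT; rewrite /= !rmorph1 !mulr1 => <-.
  by apply: eq_bigr => m _; rewrite mulr1.
- apply/rowP => l; rewrite summxE !mxE -wsum ?mem_iota ?(ltn_trans (ltn_ord l))//.
  by apply: eq_bigr => m _; rewrite !mxE.
- by rewrite zr_gt0.
Qed.

Lemma noncollinear_point i j n t : noncollinear i j n ->
  point n - point i <> t *: (point j - point i).
Proof.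
move=> /hasP[l l4 /hasP[l' l'4 +]] /rowP E; apply/negP/negPn.
move: l4 l'4; rewrite !mem_iota /= !add0n => l4 l'4.
have := E (Ordinal l4); have := E (Ordinal l'4); rewrite !mxE /= => El' El.
rewrite -subr_eq0 -zr_eq0 rmorphB !rmorphM !rmorphB /= El El'.
by rewrite mulrCA mulrA [t * _ * _]mulrC subrr.
Qed.

Lemma adjacent_point i j : i \in iota 0 32 -> j \in iota 0 32 ->
  adjacent witness (point i) (point j) <-> neighbours i j.
Proof.
move=> i32 j32; split=> [[_ _ Nij [F [PF F1 Fi Fj]]]|ij].
  have /allP/(_ i i32)/allP/(_ j j32) := separated_non_neighbours.
  move=> /or3P[/eqP ij|//|]; first by case: Nij; rewrite ij.
  move=> /(separated_face i32 j32)/(_ PF Fi Fj)[n Fn ijn].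
  have [t tE] := has_dim1_collinear F1 Fi Fj Fn Nij.
  by case: (noncollinear_point ijn tE).
have Nij : point i <> point j.
  move=> /(point_inj i32 j32) E; move: ij.
  rewrite E /neighbours (eq_count (a2 := pred0)) ?count_pred0// => l.
  by rewrite /= eqxx.
have /allP/(_ i i32)/allP/(_ j j32)/implyP/(_ ij) := exposes_edge.
move=> /exposes_face; rewrite points_seq2 => PF.
split=> //; [exact: point_vertex|exact: point_vertex|].
exists (convex_hull [set point i; point j]); split.
- by apply: PF; apply/allP/and3P.
- exact: has_dim1_convex_hull2.
- by apply: sub_convex_hull; left.
- by apply: sub_convex_hull; right.
Qed.

(** * The graph isomorphism with the 5-cube *)

Definition bits (n : 'I_32) : {ffun 'I_5 -> bool} := [ffun l : 'I_5 => bit n l].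

Lemma bits_inj : injective bits.
Proof.
move=> m n /ffunP mn; apply/val_inj/eqP; apply: contraTT isT => Nmn.
have : all (fun i => all (fun j =>
    (i == j) || has (fun l => bit i l != bit j l) (iota 0 5))
  (iota 0 32)) (iota 0 32) by [].
move=> /allP/(_ (val m)); rewrite ord_iota => /(_ isT).
move=> /allP/(_ (val n)); rewrite ord_iota => /(_ isT).
rewrite (negbTE Nmn) => /hasP[l]; rewrite mem_iota => /= l5.
by have := mn (Ordinal l5); rewrite !ffunE /= => ->; rewrite eqxx.
Qed.

Lemma bits_bij : bijective bits.
Proof.
apply: inj_card_bij bits_inj _.
by rewrite card_ffun card_bool !card_ord.
Qed.

Lemma neighboursP (m n : 'I_32) :
  neighbours m n <-> exists i, forall l, (bits m l != bits n l) = (l == i).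
Proof.
rewrite /neighbours -sum1_count -/(index_iota 0 5) big_mkord sum1dep_card.
split=> [/cards1P[i /setP mn]|[i mn]].
  by exists i => l; have := mn l; rewrite !inE !ffunE.
by apply/cards1P; exists i; apply/setP => l; rewrite !inE -mn !ffunE.
Qed.

Lemma witness_graph : graph_isomorphic witness (@cube R 5).
Proof.
(* The number of a vertex is looked up in the list, and its binary digits give the corner. *)
pose f (x : 'rV[R]_4) : 'rV[R]_5 :=
  corner R (bits (inord (index x [seq point n | n <- iota 0 32]))).
have fE (n : 'I_32) : f (point n) = corner R (bits n).
  rewrite /f; congr (corner _ (bits _)); apply: val_inj.
  have -> : index (point n) [seq point n | n <- iota 0 32] = n.
    have -> : point n = nth 0 [seq point n | n <- iota 0 32] n.
      by rewrite (nth_map 0%N) ?size_iota// nth_iota.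
    rewrite index_uniq ?size_map ?size_iota//.
    by rewrite map_inj_in_uniq ?iota_uniq//; exact: point_inj.
  by rewrite inord_val.
have ptE x : vertices witness x -> exists n : 'I_32, x = point n.
  rewrite vertices_witness => -[n + <-]; rewrite /mkset mem_iota => n32.
  by exists (Ordinal n32).
exists f; split; first split.
- by move=> _ /ptE[n ->]; rewrite fE vertices_cube; exists (bits n).
- move=> x y; rewrite !inE => /ptE[m ->] /ptE[n ->].
  by rewrite !fE => /corner_inj/bits_inj ->.
- rewrite vertices_cube => _ [b _ <-]; have [g _ gK] := bits_bij.
  by exists (point (g b)); rewrite ?fE ?gK//; exact/point_vertex/ord_iota.
- move=> _ _ /ptE[m ->] /ptE[n ->]; rewrite !fE.
  by rewrite adjacent_point ?ord_iota// adjacent_corner neighboursP.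
Qed.

Lemma has_dim_witness : has_dim witness 4.
Proof.
exists 0, fullv; split; last by rewrite dimvf.
apply/seteqP; split=> x //= _; first by rewrite memvf.
(* Barycentric coordinates of [x] in the vertices 1, 0, 2, 9, 17. Among these only vertex 0 has a
   nonzero third coordinate and only vertex 2 a nonzero fourth; 9 and 17 are vertex 1 with one sign
   flipped. *)
pose a : R := - x 0 2%:R / 5%:R; pose c : R := x 0 3%:R / 5%:R.
pose u : R := (6%:R - x 0 0 - 5%:R * a) / 12%:R.
pose v : R := (6%:R - x 0 1 - 5%:R * a) / 12%:R.
pose w := [:: 1 - a - c - u - v; a; c; u; v].
exists 5%N, (fun i => point (nth 0%N [:: 1; 0; 2; 9; 17]%N i)), (fun i => w`_i).
split.
- move=> i; apply: sub_convex_hull; eexists; last reflexivity.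
  by case: i => -[|[|[|[|[|]]]]].
- by rewrite !big_ord_recl big_ord0 /=; lra.
- apply/rowP => -[[|[|[|[|//]]]] l4]; rewrite summxE !big_ord_recl big_ord0;
    rewrite !mxE /= /zr /comp; repeat match goal with |- context[int_of_Z ?z] =>
      let k := eval vm_compute in (int_of_Z z) in change (int_of_Z z) with k end.
  + by rewrite (_ : Ordinal l4 = 0); [rewrite /v /u; lra | exact: val_inj].
  + by rewrite (_ : Ordinal l4 = 1); [rewrite /v /u; lra | exact: val_inj].
  + by rewrite (_ : Ordinal l4 = 2%:R); [rewrite /a; lra | exact: val_inj].
  + by rewrite (_ : Ordinal l4 = 3%:R); [rewrite /c; lra | exact: val_inj].
Qed.

(** * The facet with twelve vertices *)

(** An inequality exposing a vertex of the polytope also exposes it in any face containing it. *)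
Lemma vertices_bottom : vertices (convex_hull (points bottom)) = points bottom.
Proof.
apply/seteqP; split; first exact: vertices_convex_hull_sub.
move=> x [n nb <-].
apply: is_face_restrict (point_vertex (bottom_sub nb)) _ _.
- exact: is_face_sub (exposes_face exposes_bottom bottom_sub).
- by move=> _ ->; apply: sub_convex_hull; exists n.
Qed.

Lemma card_points_bottom : (points bottom #= `I_12)%card.
Proof.
have pb : (points bottom #= [set` bottom])%card.
  apply: inj_card_eq => m n; rewrite !inE => mb nb.
  by apply: point_inj; exact: bottom_sub.
apply: card_eq_trans pb _.
have -> : [set` bottom] = nth 0%N bottom @` `I_12.
  apply/seteqP; split=> [n nb|_ [i i12 <-]]; last exact: mem_nth.
  exists (index n bottom); last exact: nth_index.
  by rewrite /mkset -[12%N]/(size bottom) index_mem.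
apply: inj_card_eq => m n; rewrite !inE => m12 n12 /eqP.
by rewrite nth_uniq// => /eqP.
Qed.

Lemma witness_not_cubical : ~ cubical witness.
Proof.
move=> /(_ _ (exposes_face exposes_bottom bottom_sub))[].
- move=> /(congr1 (@vertices R 4)); rewrite vertices_bottom vertices_witness => E.
  (* Vertex 4 lies over an interior point of the triangle, so the facet is proper. *)
  have : points bottom (point 4) by rewrite E; exists 4%N.
  move=> [n nb n4]; have {}n4 : n = 4%N by exact: point_inj (bottom_sub nb) _ n4.
  by rewrite n4 in nb.
- move=> E; have : set0 (point 0) by rewrite -E; apply: sub_convex_hull; exists 0%N.
  by [].
- move=> _ [k bottom_cube].
  have bottom_vertex F : is_face (convex_hull (points bottom)) F -> F <> set0 ->
      exists2 v, vertices (convex_hull (points bottom)) v & F v.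
    by apply: face_convex_hull_vertex; rewrite vertices_bottom.
  have {}bottom_cube :=
    comb_equiv_card_vertices bottom_vertex (@cube_face_vertex R k) bottom_cube.
  rewrite vertices_bottom in bottom_cube.
  have : (`I_12 #= `I_(2 ^ k))%card.
    apply: card_eq_trans (card_vertices_cube R k).
    by apply: card_eq_trans bottom_cube; rewrite card_eq_sym card_points_bottom.
  (* A cube would need [2 ^ k = 12]; the powers with [k <= 3] are at most 8, the others are
     multiples of 16. *)
  move=> /card_eq_II; case: k {bottom_cube} => [|[|[|[|k]]]] //.
  by rewrite !expnS; lia.
Qed.

End Witness.

Theorem mainTheorem6 (R : realType) :
  exists (d : nat) (P : set 'rV[R]_d),
    [/\ is_polytope P,
        has_dim P 4,
        graph_isomorphic P (@cube R 5) &
        ~ cubical P].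
Proof.
exists 4%N, (@witness R); split.
- exists (@points R (iota 0 32)); split=> //.
  exact/finite_image/finite_seq.
- exact: has_dim_witness.
- exact: witness_graph.
- exact: witness_not_cubical.
Qed.
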